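(* Let $(X,d,\mu)$ be a complete, connected metric measure space with $\mu$ a doubling Borel regular measure, let $\Omega\subset X$ be a bounded domain, and let $0<s<1$. Then there exists a constant $\gamma_0>0$, depending only on $s$ and the doubling constant of $\mu$, such that if $E\subset X$ is a minimizer of $\mathcal{J}_\Omega^s$, then after possibly modifying $E$ on a set of $\mu$-measure zero, for all $x_0\in\partial E\cap\Omega$ and all $R_0>0$ with $B(x_0,2R_0)\subset\Omega$ we have \[\frac{\mu(B(x_0,R_0)\cap E)}{\mu(B(x_0,R_0))}\ge\gamma_0\quad\text{and}\quad\frac{\mu(B(x_0,R_0)\setminus E)}{\mu(B(x_0,R_0))}\ge\gamma_0.\]
   Context: $\mu$ is doubling if there is $C_\mu\ge1$ with $0<\mu(B(x,2r))\le C_\mu\mu(B(x,r))<\infty$ for all $x\in X$, $r>0$. A domain is a connected open set; $\partial E$ denotes the topological boundary. For $x,y\in X$ let $K_s(x,y)=\frac{2}{d(x,y)^s[\mu(B(x,d(x,y)))+\mu(B(y,d(x,y)))]}$ and for measurable $A,B\subset X$ let $L_s(A,B)=\int_A\int_BK_s(x,y)\,d\mu(y)\,d\mu(x)$. Define $\mathcal{J}^s_\Omega(E)=L_s(E\cap\Omega,X\setminus E)+L_s(E\setminus\Omega,\Omega\setminus E)$. Given a measurable set $F\subset X$ with $F\setminus\Omega\neq\emptyset$, a measurable set $E\subset X$ is a minimizer of $\mathcal{J}^s_\Omega$ if $\mathcal{J}^s_\Omega(E)<\infty$, $E\setminus\Omega=F\setminus\Omega$, and $\mathcal{J}^s_\Omega(E)\le\mathcal{J}^s_\Omega(E')$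 for all measurable $E'\subset X$ with $E'\setminus\Omega=F\setminus\Omega$. *)

(* Defs.v *)
From HB Require Import structures.
From mathcomp Require Import all_boot all_order all_algebra.
From mathcomp Require Import all_classical all_reals all_analysis.
Set Implicit Arguments. Unset Strict Implicit. Unset Printing Implicit Defensive.
Import Order.TTheory GRing.Theory Num.Theory.
Local Open Scope classical_set_scope.
Local Open Scope ring_scope.

Section MetricNotions.
Context {R : realType} {T : Type} (dist : T -> T -> R).

Definition is_metric : Prop :=
  [/\ (forall x y, 0 <= dist x y),
      (forall x y, dist x y = 0 <-> x = y),
      (forall x y, dist x y = dist y x) &
      (forall x y z, dist x z <= dist x y + dist y z)].

Definition dball (x : T) (r : R) : set T := [set y | dist x y < r].

Definition dopen (A : set T) : Prop :=
  forall x, A x -> exists2 r : R, 0 < r & dball x r `<=` A.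

Definition dcomplete : Prop :=
  forall u : nat -> T,
    (forall e : R, 0 < e -> exists N : nat, forall m n : nat,
        (N <= m)%N -> (N <= n)%N -> dist (u m) (u n) < e) ->
    exists l : T, forall e : R, 0 < e -> exists N : nat, forall n : nat,
        (N <= n)%N -> dist (u n) l < e.

Definition dconnected (A : set T) : Prop :=
  forall U V : set T, dopen U -> dopen V ->
    A `<=` U `|` V -> A `&` U `&` V = set0 ->
    A `&` U = set0 \/ A `&` V = set0.

Definition dbounded (A : set T) : Prop :=
  exists x : T, exists r : R, A `<=` dball x r.

Definition ddomain (A : set T) : Prop := dopen A /\ dconnected A.

Definition dboundary (E : set T) : set T :=
  [set x | forall r : R, 0 < r ->
     dball x r `&` E !=set0 /\ dball x r `&` ~` E !=set0].

Definition dborel : set (set T) := <<s dopen >>.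

End MetricNotions.

Section MeasureNotions.
Context {R : realType} {disp : measure_display} {T : measurableType disp}
  (dist : T -> T -> R) (mu : {measure set T -> \bar R}).

Local Open Scope ereal_scope.

Definition doubling_with (C : R) : Prop :=
  (1 <= C)%R /\
  forall (x : T) (r : R), (0 < r)%R ->
    0 < mu (dball dist x (2 * r)) /\
    mu (dball dist x (2 * r)) <= C%:E * mu (dball dist x r) /\
    C%:E * mu (dball dist x r) < +oo.

Definition borel_regular : Prop :=
  (forall A, dborel dist A -> measurable A) /\
  (forall A, measurable A ->
     exists B, [/\ dborel dist B, A `<=` B & mu A = mu B]).

Definition Ks (s : R) (x y : T) : \bar R :=
  2%:E * (((dist x y) `^ s)%:E *
          (mu (dball dist x (dist x y)) + mu (dball dist y (dist x y))))^-1.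

Definition Ls (s : R) (A B : set T) : \bar R :=
  \int[mu]_(x in A) \int[mu]_(y in B) Ks s x y.

Definition Js (s : R) (Omega E : set T) : \bar R :=
  Ls s (E `&` Omega) (~` E) + Ls s (E `\` Omega) (Omega `\` E).

Definition is_minimizer (s : R) (Omega F E : set T) : Prop :=
  [/\ measurable E, Js s Omega E < +oo, E `\` Omega = F `\` Omega &
      forall E' : set T, measurable E' -> E' `\` Omega = F `\` Omega ->
        Js s Omega E <= Js s Omega E'].

End MeasureNotions.

(* Main.v *)
(** De Giorgi iteration.  Let E be a minimizer, A_r = E ∩ B(x0, r) and
    V(r) = mu(A_r).  Comparing E with E \ B(x0, r) gives
    L(A_r, X \ E) <= L(A_r, E \ B(x0, r)), hence
    L(A_r, X \ A_r) <= 2 L(A_r, X \ B(x0, r)).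
    If V(r) is at most half of mu(B(x, t)) for every x in A_r, the left side is
    at least c t^-s V(r), because half of each ball B(x, t) lies outside A_r.
    The inner integral of the right side is at most c (r - d(x0, x))^-s;
    averaging over r in ]r1, r2] makes this singularity integrable since s < 1
    and gives V(r1) <= c (t / (r2 - r1))^s V(r2).
    With r_j = R0 (1 + 2^-j) / 2 and t_j = 2^-(j + k0) R0 for a large fixed k0,
    each step divides V by the doubling constant, which in turn keeps t_j
    admissible at the next step.  So if V(R0) / mu(B(x0, R0)) is small, then
    V(R0 / 2) = 0, which is impossible at a boundary point of the representative
    of E that contains its measure-theoretic interior and avoids its
    measure-theoretic exterior.  The complement of E is a minimizer for the
    complementary exterior datum, which gives the second bound. *)

Require Import Defs.
From HB Require Import structures.
From mathcomp Require Import all_boot all_order all_algebra.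
From mathcomp Require Import all_classical all_reals all_analysis.
From mathcomp Require Import measurable_realfun ring lra.
Import Order.TTheory GRing.Theory Num.Theory.
Local Open Scope classical_set_scope.
Local Open Scope ring_scope.

(** * Measure-theoretic preliminaries *)

Section SigmaFinite.
Context {R : realType} {disp : measure_display} {T : measurableType disp}.
Context (mu : {measure set T -> \bar R}).
Hypothesis mu_sf : sigma_finite setT mu.
Local Open Scope ereal_scope.

(* A copy of [mu] that carries the sigma-finite structure as an instance. *)
Definition sigma_finite_pack of sigma_finite setT mu : set T -> \bar R := mu.

Local Notation m := (sigma_finite_pack mu_sf).

HB.instance Definition _ := isMeasure.Build _ _ _ m (measure0 mu)
  (measure_ge0 mu) (@measure_semi_sigma_additive _ _ _ mu).

HB.instance Definition _ := @Measure_isSigmaFinite.Build _ _ _ m mu_sf.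

Lemma measurable_fun_section d' (S : measurableType d') (A : set (S * T)) :
  measurable A -> measurable_fun setT (fun x => mu [set y | A (x, y)]).
Proof.
move=> mA; apply: eq_measurable_fun (measurable_fun_xsection m mA).
by move=> x _; rewrite /= xsectionE.
Qed.

Lemma measurable_fun_inner_integral d' (S : measurableType d')
    (f : S * T -> \bar R) :
  measurable_fun setT f -> (forall z, 0 <= f z) -> forall D, measurable D ->
  measurable_fun setT (fun x => \int[mu]_(y in D) f (x, y)).
Proof.
move=> mf f0 D mD.
have mg : measurable_fun setT (f \_ (setT `*` D)).
  apply/(measurable_restrictT _ (measurableX _ _)) => //.
  exact: (measurable_funS _ _ mf).
have g0 z : 0 <= (f \_ (setT `*` D)) z by rewrite patchE; case: ifP.
apply: eq_measurable_fun (@measurable_fun_fubini_tonelli_F _ _ _ _ _ m _ mg g0).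
move=> x _; rewrite /fubini_F [RHS]integral_mkcond; apply: eq_integral => y _.
by rewrite !patchE; congr (if _ then _ else _); rewrite in_setX in_setT.
Qed.

End SigmaFinite.

Lemma tonelli_sets {R : realType} {d1 d2} {T1 : measurableType d1}
  {T2 : measurableType d2} (m1 : {measure set T1 -> \bar R})
  (m2 : {measure set T2 -> \bar R}) (f : T1 * T2 -> \bar R) A B :
  sigma_finite setT m1 -> sigma_finite setT m2 ->
  measurable_fun setT f -> (forall z, 0 <= f z)%E ->
  measurable A -> measurable B ->
  (\int[m1]_(x in A) \int[m2]_(y in B) f (x, y) =
   \int[m2]_(y in B) \int[m1]_(x in A) f (x, y))%E.
Proof.
move=> s1 s2 mf f0 mA mB.
have mg : measurable_fun setT (f \_ (A `*` B)).
  apply/(measurable_restrictT _ (measurableX _ _)) => //.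
  exact: (measurable_funS _ _ mf).
have g0 z : (0 <= (f \_ (A `*` B)) z)%E by rewrite patchE; case: ifP.
have lr := @fubini_tonelli _ _ _ _ _ (sigma_finite_pack _ s1)
  (sigma_finite_pack _ s2) _ mg g0.
etransitivity; [|etransitivity; [exact: lr|]].
  rewrite integral_mkcond; apply: eq_integral => x _; rewrite patchE.
  case: ifPn => xA.
    rewrite integral_mkcond; apply: eq_integral => y _.
    by rewrite !patchE in_setX xA.
  by rewrite integral0_eq// => y _; rewrite patchE in_setX (negbTE xA).
rewrite [RHS]integral_mkcond; apply: eq_integral => y _; rewrite patchE.
case: ifPn => yB.
  rewrite [RHS]integral_mkcond; apply: eq_integral => x _.
  by rewrite !patchE in_setX yB andbT.
by rewrite integral0_eq// => x _; rewrite patchE in_setX (negbTE yB) andbF.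
Qed.

Lemma measurable_fun_sublevel {R : realType} {d} {T : measurableType d} (f : T -> R) :
  (forall r, measurable [set x | f x < r]) -> measurable_fun setT f.
Proof.
move=> h; apply: (measurability (@RGenInftyO.G R) (@RGenInftyO.measurableE R)).
by move=> _ [_ [r ->] <-]; rewrite setTI; exact: h.
Qed.

Lemma measurable_inve_EFin {R : realType} :
  measurable_fun [set: R] (fun r => (r%:E^-1)%E).
Proof.
(* The extended inverse is [+oo] at 0. Below 0, where [powR] is not a true power, two sign changes
   reduce to the positive side. *)
apply: (eq_measurable_fun (fun r : R => if r == 0 then +oo%E else
    if 0 < r then (r `^ (-1))%:E else (- ((- r) `^ (-1)))%:E)).
  move=> r _ /=; rewrite inver; have [//|r0] := eqVneq r 0.
  have [r1|r1] := ltP 0 r; first by rewrite powR_inv1// ltW.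
  by rewrite powR_inv1 ?oppr_ge0// invrN opprK.
apply: measurable_fun_ifT; [exact: measurable_fun_eqr|exact: measurable_cst|].
apply: measurable_fun_ifT; first exact: measurable_fun_ltr.
  by apply/measurable_EFinP; exact: measurable_powR.
apply/measurable_EFinP; apply: measurable_funN.
by apply: (measurableT_comp (measurable_powR _)); exact: oppr_measurable.
Qed.

Lemma geometric_nneseries_le {R : realType} (a : nat -> \bar R) (b q : R) :
  0 <= b -> 0 <= q < 1 -> (forall k, 0 <= a k <= (b * q ^+ k)%:E)%E ->
  (\sum_(0 <= k <oo) a k <= (b / (1 - q))%:E)%E.
Proof.
move=> b0 /andP[q0 q1] ha; apply: lime_le.
  by apply: is_cvg_nneseries => k _ _; have /andP[] := ha k.
apply: nearW => n.
apply: (@le_trans _ _ (\sum_(0 <= k < n) (b * q ^+ k)%:E)%E).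
  by apply: lee_sum => k _; have /andP[] := ha k.
rewrite sumEFin lee_fin.
have -> : \sum_(0 <= k < n) b * q ^+ k = b * (1 - q ^+ n) / (1 - q).
  by have /(congr1 (@^~ n)) := @geometric_seriesE R b q (negbT (lt_eqF q1)).
by rewrite ler_pM2r ?invr_gt0 ?subr_gt0// ler_piMr// lerBlDr lerDl exprn_ge0.
Qed.

(* The covering sets need not be disjoint: [f] is dominated on [D] by the sum
   of the step functions [a k] on [S k]. *)
Lemma integral_shells_le {R : realType} {d} {T : measurableType d}
    (m : {measure set T -> \bar R}) (D : set T) (f : T -> \bar R)
    (S : nat -> set T) (a : nat -> R) (b q : R) :
  measurable D -> measurable_fun D f -> (forall x, D x -> 0 <= f x)%E ->
  (forall k, measurable (S k)) -> D `<=` \bigcup_k S k ->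
  (forall k, 0 <= a k) ->
  (forall k x, D x -> S k x -> f x <= (a k)%:E)%E ->
  0 <= b -> 0 <= q < 1 ->
  (forall k, (a k)%:E * m (S k) <= (b * q ^+ k)%:E)%E ->
  (\int[m]_(x in D) f x <= (b / (1 - q))%:E)%E.
Proof.
move=> mD mf f0 mS DS a0 fa b0 q01 aS.
have h0 k x : (0 <= (a k * \1_(S k) x)%:E)%E by rewrite lee_fin mulr_ge0.
have mh k : measurable_fun D (fun x => (a k * \1_(S k) x)%:E).
  by apply/measurable_EFinP; apply: measurable_funM => //; exact: measurable_indic.
apply: (@le_trans _ _ (\int[m]_(x in D) \sum_(0 <= k <oo) (a k * \1_(S k) x)%:E)%E).
  apply: ge0_le_integral => //.
    exact: ge0_emeasurable_sum.
  move=> x Dx; have [k _ Skx] := DS x Dx.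
  apply: (le_trans (fa k x Dx Skx)).
  apply: le_trans (nneseries_lim_ge k.+1 _) => //.
  rewrite big_nat_recr//= indicE mem_set// mulr1 leeDr//.
  by apply: sume_ge0 => i _; rewrite lee_fin mulr_ge0.
rewrite integral_nneseries//; apply: geometric_nneseries_le => // k.
rewrite integral_ge0//=; apply: le_trans (aS k).
under eq_integral do rewrite EFinM.
rewrite ge0_integralZl_EFin//; last first.
  by apply/measurable_EFinP; exact: measurable_indic.
rewrite integral_indic// lee_wpmul2l ?lee_fin//.
by apply: le_measure; rewrite ?inE//; exact: measurableI.
Qed.

Lemma lee_cancel {R : realType} (a b c x y : \bar R) :
  (x + y \is a fin_num -> (a + x) + y <= (x + b) + (y + c) -> a <= b + c)%E.
Proof. by move=> xy; rewrite -addeA [leRHS]addeACA [leRHS]addeC leeD2rE. Qed.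

Lemma powR_gt1 {R : realType} (a r : R) : 1 < a -> 0 < r -> 1 < a `^ r.
Proof.
move=> a1 r0; have := @gt0_ltr_powR R r r0 1 a _ _ a1.
by rewrite powR1; apply; rewrite nnegrE ?ler01// (le_trans ler01) ?ltW.
Qed.

Lemma powR_exprn {R : realType} (a s : R) n : 0 <= a ->
  (a ^+ n) `^ s = (a `^ s) ^+ n.
Proof.
move=> a0; elim: n => [|n IH]; first by rewrite !expr0 powR1.
by rewrite !exprS powRM ?exprn_ge0// IH.
Qed.

Lemma powRV {R : realType} (a s : R) : 0 <= a -> a^-1 `^ s = (a `^ s)^-1.
Proof. by move=> a0; rewrite -(powR_inv1 a0) powRAC powR_inv1// powR_ge0. Qed.

(** * Integral of a truncated power over an interval of radii *)

Section RadialIntegral.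
Context {R : realType}.
Local Notation leb := (@lebesgue_measure R).

(* Cut off at 0 because [powR] takes the junk value 1 at negative reals. *)
Definition neg_powR (s t : R) : R := if 0 < t then t `^ (- s) else 0.

Lemma neg_powR_ge0 s t : 0 <= neg_powR s t.
Proof. by rewrite /neg_powR; case: ifP => // _; exact: powR_ge0. Qed.

Lemma measurable_neg_powR s : measurable_fun setT (neg_powR s).
Proof.
apply: measurable_fun_ifT; [exact: measurable_fun_ltr| |exact: measurable_cst].
exact: measurable_powR.
Qed.

Lemma neg_powR_le s t u : 0 <= s -> 0 < t -> t <= u -> neg_powR s u <= t `^ (- s).
Proof.
move=> s0 t0 tu; rewrite /neg_powR (lt_le_trans t0 tu) !powRN.
rewrite lef_pV2 ?posrE ?powR_gt0//; last exact: lt_le_trans tu.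
by rewrite ge0_ler_powR// ?nnegrE ltW// (lt_le_trans t0 tu).
Qed.

(** Dyadic shells to the right of [rho] contribute a geometric series of ratio [2^s / 2], which is
    below 1 because s < 1. The bound is uniform in [rho]. *)
Lemma integral_neg_powR_le (s r1 r2 rho : R) : 0 < s < 1 -> r1 < r2 ->
  (\int[leb]_(r in `]r1, r2]) (neg_powR s (r - rho))%:E <=
   ((r2 - r1) * (r2 - r1) `^ (- s) * 2 `^ s / (1 - 2 `^ s / 2))%:E)%E.
Proof.
move=> /andP[s0 s1] r12; set l := r2 - r1.
have l0 : 0 < l by rewrite subr_gt0.
have b1 : 1 < 2 `^ s :> R by rewrite powR_gt1// ltr1n.
have b2 : 2 `^ s < 2 :> R.
  rewrite -[ltRHS]powRr1// -subr_gt0 -(@ltr_pM2l _ (2 `^ (- s))) ?powR_gt0//.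
  rewrite mulr0 mulrBr -!powRD ?pnatr_eq0 ?implybT// addNr powRr0 subr_gt0.
  by rewrite powR_gt1 ?ltr1n// addrC subr_gt0.
have p2 k : 0 < l / 2 ^+ k by rewrite divr_gt0// exprn_gt0.
have mD : measurable `]r1, r2]%classic by [].
(* The shell of index 0 takes the rest of the interval: the part left of [rho], where the integrand
   is 0, and the part beyond [rho + l / 2]. Its length can reach [l], so lengths are bounded by
   [l / 2^k] and not by half of that. *)
pose S k := if k is 0 then `]r1, r2] `\` `]rho, rho + l / 2]
  else `]rho + l / 2 ^+ k.+1, rho + l / 2 ^+ k]%classic.
have mS k : measurable (S k).
  by case: k => [|k]; [exact: measurableD|exact: measurable_itv].
apply: (@integral_shells_le _ _ _ leb _ _ S (fun k => (l / 2 ^+ k.+1) `^ (- s))) => //.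
- apply/measurable_EFinP; apply: (measurable_funS measurableT) => //.
  apply: (measurableT_comp (measurable_neg_powR s)).
  by apply: measurable_funB => //; exact: measurable_id.
- by move=> x _; rewrite lee_fin neg_powR_ge0.
- move=> r Dr; have [rr|rr] := leP r rho.
    by exists 0%N => //; split => //=; rewrite in_itv/= => /andP[]; rewrite ltNge rr.
  have ex : exists n, l / 2 ^+ n.+1 < r - rho.
    exists (Num.truncn (l / (r - rho))).
    rewrite ltr_pdivrMr ?exprn_gt0// mulrC -ltr_pdivrMr ?subr_gt0//.
    by apply: lt_trans (truncnS_gt _) _; rewrite -natrX ltr_nat ltn_expl.
  pose n := ex_minn ex; exists n => //.
  rewrite /n; case: ex_minnP => -[|m] hm minm.
    by split => //=; rewrite in_itv/= => /andP[_]; move: hm; rewrite expr1; lra.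
  have : l / 2 ^+ m.+1 >= r - rho by rewrite leNgt; apply/negP => /minm; rewrite ltnn.
  by rewrite /S/= in_itv/=; move: hm; set u := l / _; set v := l / _; lra.
- by move=> k; exact: powR_ge0.
- move=> k r Dr Sr; rewrite lee_fin.
  have [rr|rr] := leP (r - rho) 0.
    by rewrite /neg_powR ltNge rr/= powR_ge0.
  apply: neg_powR_le => //; first exact: ltW.
  case: k Sr => [[_]|k] /=; rewrite in_itv/=.
    move/negP; rewrite negb_and expr1 -!leNgt => /orP[]; first by lra.
    by rewrite -ltNge; lra.
  by move=> /andP[+ _]; set u := l / _; lra.
- by rewrite !mulr_ge0 ?powR_ge0// ltW.
- by rewrite divr_ge0 ?powR_ge0//= ltr_pdivrMr// mul1r.
move=> k.
apply: (@le_trans _ _ (((l / 2 ^+ k.+1) `^ (- s))%:E * (l / 2 ^+ k)%:E)%E).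
  rewrite lee_wpmul2l//; first by rewrite lee_fin powR_ge0.
  case: k => [|k].
    apply: (@le_trans _ _ (leb `]r1, r2])).
      by apply: le_measure; rewrite ?inE//; [have := mS 0%N|exact: subDsetl].
    by rewrite lebesgue_measure_itv/= lte_fin r12 expr0 divr1 -EFinD.
  rewrite /S/= lebesgue_measure_itv/= lte_fin.
  case: ifP => _; last by rewrite lee_fin ltW.
  rewrite -EFinD lee_fin; have := p2 k.+2; set u := l / _; set v := l / _; lra.
rewrite -EFinM lee_fin powRM; [|exact: ltW|by rewrite invr_ge0 exprn_ge0].
have -> : (2 ^+ k.+1)^-1 `^ (- s) = (2 `^ s) ^+ k.+1.
  by rewrite -powR_inv1 ?exprn_ge0// -powRrM mulrNN mul1r powR_exprn.
rewrite le_eqVlt; apply/orP; left; apply/eqP.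
rewrite expr_div_n exprS; field.
by rewrite expf_neq0.
Qed.

End RadialIntegral.

Lemma expr_unbounded {R : realType} (b M : R) : 1 < b -> exists n, M < b ^+ n.
Proof.
move=> b1; have b10 : 0 < b - 1 by rewrite subr_gt0.
exists (Num.truncn (M / (b - 1))).+1.
apply: (@lt_le_trans _ _ ((Num.truncn (M / (b - 1))).+1%:R * (b - 1))).
  by rewrite -ltr_pdivrMr// truncnS_gt.
elim: _.+1 => [|n IH]; first by rewrite mul0r.
have bn : 1 <= b ^+ n by rewrite exprn_ege1// ltW.
rewrite exprS -natr1; nra.
Qed.

(* If [decay_const s C <= 2^(s k0)], each step of the iteration with radii
   [r_j = R0 (1 + 2^-j) / 2] and scales [t_j = 2^-(j + k0) R0] divides the volume
   by [C]. *)
Definition decay_const {R : realType} (s C : R) : R :=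
  2 * (1 + C) * (2 * C / (1 - (2 `^ s)^-1) * (2 `^ s / (1 - 2 `^ s / 2)))
  * (2 `^ s) ^+ 2 * C.

(** Used with [x], [y], [z] the interactions of A_r with X \ E, E \ B(x0, r) and X \ B(x0, r):
    minimality gives [x <= y] and inclusion gives [y <= z]. *)
Lemma lee_half {R : realType} (k : R) (m x y z : \bar R) :
  (k%:E * m <= x + y -> 0 <= z -> x <= y -> y <= z -> (k / 2)%:E * m <= z)%E.
Proof.
move=> kxy z0 xy yz; rewrite -(@lee_pmul2l _ 2%:E)// muleA -EFinM mulrCA.
rewrite divff// mulr1; apply: (le_trans kxy).
have -> : (2%:E = 1 + 1 :> \bar R)%E by rewrite -EFinD.
by rewrite ge0_muleDl// !mul1e leeD// (le_trans xy).
Qed.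

(** * Doubling metric measure spaces *)

Section MetricMeasure.
Context {R : realType} {disp : measure_display} {T : measurableType disp}.
Context (dist : T -> T -> R) (mu : {measure set T -> \bar R}) (C : R).
Hypothesis dist_metric : is_metric dist.
Hypothesis mu_doubling : doubling_with dist mu C.
Hypothesis dopen_measurable : forall A, dopen dist A -> measurable A.
Local Notation B := (dball dist).

Lemma dist_ge0 x y : 0 <= dist x y.
Proof. by case: dist_metric. Qed.

Lemma dist_sym x y : dist x y = dist y x.
Proof. by case: dist_metric. Qed.

Lemma dist_refl x : dist x x = 0.
Proof. by case: dist_metric => _ h _ _; apply/h. Qed.

Lemma dist_gt0 x y : x <> y -> 0 < dist x y.
Proof.
case: dist_metric => _ h _ _ xy; rewrite lt_neqAle dist_ge0 andbT eq_sym.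
by apply/eqP => /h.
Qed.

Lemma dist_triangle x y z : dist x z <= dist x y + dist y z.
Proof. by case: dist_metric. Qed.

Lemma subset_dball x y r t : dist x y + r <= t -> B y r `<=` B x t.
Proof.
by move=> rt z; rewrite /dball/= => h; have := dist_triangle x y z; lra.
Qed.

Lemma dopen_dball x r : dopen dist (B x r).
Proof.
move=> y xy; exists (r - dist x y); first by rewrite subr_gt0.
by apply: subset_dball; lra.
Qed.

Lemma measurable_dball x r : measurable (B x r).
Proof. exact/dopen_measurable/dopen_dball. Qed.
#[local] Hint Resolve measurable_dball : core.

Lemma dball_eq0 x r : r <= 0 -> B x r = set0.
Proof.
move=> r0; apply/seteqP; split => // y; rewrite /dball/= => h.
by have := dist_ge0 x y; lra.
Qed.

Lemma doubling_ge1 : 1 <= C.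
Proof. by case: mu_doubling. Qed.

Lemma doubling_ball x r : 0 < r -> (mu (B x (2 * r)) <= C%:E * mu (B x r))%E.
Proof. by case: mu_doubling => _ h /(h x)[_ []]. Qed.

Lemma mu_dball_gt0 x r : 0 < r -> (0 < mu (B x r))%E.
Proof.
move=> r0; case: mu_doubling => _ /(_ x (r / 2)); rewrite divr_gt0// => /(_ isT)[].
by rewrite mulrCA divff// mulr1.
Qed.

Lemma mu_dball_fin_num x r : mu (B x r) \is a fin_num.
Proof.
have [r0|r0] := leP r 0; first by rewrite dball_eq0// measure0.
case: mu_doubling => C1 /(_ x r r0)[_ [_]] h; rewrite ge0_fin_numE//.
by apply: le_lt_trans h; rewrite lee_pemull.
Qed.

Lemma mu_dball_lty x r : (mu (B x r) < +oo)%E.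
Proof. by rewrite -ge0_fin_numE// mu_dball_fin_num. Qed.

Lemma dball_cover p : \bigcup_n B p n%:R = setT.
Proof.
apply/seteqP; split => // y _; exists (Num.truncn (dist p y)).+1 => //.
by rewrite /dball/= truncnS_gt.
Qed.

Lemma doubling_sigma_finite (p : T) : sigma_finite setT mu.
Proof.
exists (fun n => B p n%:R); first by rewrite dball_cover.
by move=> n; split => //; exact: mu_dball_lty.
Qed.

(** * Separability and measurability of the distance *)

Lemma disjoint_balls_countable (p : T) (e : R) (D : set T) : 0 < e ->
  trivIset D (fun x => B x e) -> countable D.
Proof.
move=> e0 tD.
(* Each ball has positive mass inside some [B p m]. For fixed n, only finitely many disjoint balls
   have mass above 1/(n+1) inside [B p n], whose mass is finite. *)
rewrite (_ : D = \bigcup_n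
    (D `&` [set x | n.+1%:R^-1%:E < mu (B x e `&` B p n%:R)]%E)); last first.
  apply/seteqP; split => [x Dx|x [n _ []//]].
  have [m] : exists m, (0 < mu (B x e `&` B p m%:R))%E.
    apply: contrapT => /forallNP h.
    have nB : mu.-negligible (B x e).
      rewrite -[B x e]setIT -(dball_cover p) setI_bigcupr.
      apply: negligible_bigcup => m; apply/negligibleP; first exact: measurableI.
      by have /negP := h m; rewrite -leNgt measure_le0 => /eqP.
    have := mu_dball_gt0 x e e0.
    by rewrite (measure_negligible (measurable_dball x e) nB) ltxx.
  move=> hm.
  have fm k : mu (B x e `&` B p k%:R) \is a fin_num.
    rewrite ge0_fin_numE//; apply: le_lt_trans (mu_dball_lty x e).
    by apply: le_measure; rewrite ?inE//; exact: measurableI.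
  move: hm; rewrite -(fineK (fm m)) lte_fin => hm.
  have [k] : exists k, k.+1%:R^-1 < fine (mu (B x e `&` B p m%:R)).
    by have [k] := ltr_add_invr hm; rewrite add0r; exists k.
  move=> hk; exists (maxn k m) => //; split => //=.
  apply: (@lt_le_trans _ _ (mu (B x e `&` B p m%:R))).
    rewrite -(fineK (fm m)) lte_fin; apply: le_lt_trans hk.
    by rewrite lef_pV2 ?posrE// ler_nat ltnS leq_maxl.
  apply: le_measure; rewrite ?inE; try exact: measurableI.
  by apply: setIS; apply: subset_dball; rewrite dist_refl add0r ler_nat leq_maxr.
apply: bigcup_countable => // n _; apply: finite_set_countable.
apply: contrapT => /infiniteP/pcard_leP/injfunPex[/= q q_fun q_inj].
have tq : trivIset setT (fun k => B (q k) e `&` B p n%:R).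
  apply/trivIsetP => i j _ _ ij; rewrite setIACA setIid.
  move/trivIsetP : tD => /(_ (q i) (q j)) ->; rewrite ?set0I//.
  - by have [] := q_fun i I.
  - by have [] := q_fun j I.
  - by apply: contra_neq ij => /q_inj; apply; rewrite inE.
have mq k : measurable (B (q k) e `&` B p n%:R) by exact: measurableI.
have : (mu (\bigcup_k (B (q k) e `&` B p n%:R)) <= mu (B p n%:R))%E.
  apply: le_measure; rewrite ?inE//; first exact: bigcup_measurable.
  by move=> x [k _ []].
rewrite measure_bigcup// leNgt => /negP; apply.
rewrite -(fineK (mu_dball_fin_num p n%:R)).
set v := fine _.
have v0 : 0 <= v by exact: fine_ge0.
(* With this [N], the first [N] disjoint pieces have total mass at least N/(n+1) > v. *)
pose N := (Num.truncn (v * n.+1%:R)).+1.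
apply: (@lt_le_trans _ _ (\sum_(0 <= k < N) mu (B (q k) e `&` B p n%:R))%E); last first.
  apply: (le_trans (nneseries_lim_ge N _)); first by [].
  rewrite le_eqVlt; apply/orP; left; apply/eqP.
  by apply: eq_eseriesl => i; rewrite in_setT.
apply: (@lt_le_trans _ _ (\sum_(0 <= k < N) n.+1%:R^-1%:E)%E); last first.
  by apply: lee_sum => k _; apply/ltW; have [] := q_fun k I.
rewrite sumEFin lte_fin sumr_const_nat subn0 -[ltRHS]mulr_natr mulrC ltr_pdivlMr//.
by rewrite truncnS_gt.
Qed.

(** For each n, the centres of a maximal disjoint family of balls of radius 1/(n+1) are countably
    many, and maximality puts every point within 2/(n+1) of one of them. *)
Lemma doubling_separable (p : T) :
  exists q : nat -> T, forall x e, 0 < e -> exists n, dist x (q n) < e.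
Proof.
have /choice[D hD] (n : nat) : exists D : set T, countable D /\
    forall x, exists2 y, D y & dist x y < 2 * n.+1%:R^-1.
  have [D [_ tD mD]] :=
    ex_maximal_disjoint_subcollection (fun x => B x n.+1%:R^-1) setT.
  exists D; split; first by apply: (disjoint_balls_countable p) tD; rewrite invr_gt0.
  move=> x; have [Dx|Dx] := pselect (D x).
    by exists x => //; rewrite dist_refl mulr_gt0// invr_gt0.
  apply: contrapT => hx; apply: (mD (D `|` [set x])) => //.
    by split => [y|/(_ x)]; [left|apply: contra_not Dx; apply; right].
  move=> y z [Dy|->] [Dz|->]//; first exact: tD.
  - move=> [w [yw xw]]; exfalso; apply: hx; exists y => //.
    have := dist_triangle x w y; rewrite (dist_sym w y).
    move: yw xw; rewrite /dball/=; move: n.+1%:R^-1 => e; lra.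
  - move=> [w [yw xw]]; exfalso; apply: hx; exists z => //.
    have := dist_triangle x w z; rewrite (dist_sym w z).
    move: yw xw; rewrite /dball/=; move: n.+1%:R^-1 => e; lra.
have cD : countable (\bigcup_n D n).
  by apply: bigcup_countable => // n _; case: (hD n).
have [f hf] : exists f : nat -> T, forall y, (\bigcup_n D n) y -> exists n, f n = y.
  have /countable_injP[g ginj] := cD.
  exists (fun n => xget p [set y | (\bigcup_n D n) y /\ g y = n]) => y Dy.
  exists (g y); case: xgetP => [z -> [Dz gz]|/(_ y)]; last by case.
  by apply: ginj; rewrite ?inE.
exists f => x e e0.
have e20 : 0 < e / 2 by rewrite divr_gt0.
have [k] := ltr_add_invr e20; rewrite add0r => ke.
have [_ /(_ x)[y Dy xy]] := hD k.
have [n fn] := hf y (ex_intro2 _ _ k I Dy); exists n; rewrite fn.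
by move: ke xy; move: k.+1%:R^-1 => a; lra.
Qed.

(** * The kernel and the nonlocal perimeter *)

Context (p : T).

Let mu_sf : sigma_finite setT mu.
Proof. exact: (doubling_sigma_finite p). Qed.

(** The sigma-algebra on [T * T] is the product one, so openness of sublevel sets is not enough by
    itself. A dense sequence writes them as countable unions of sets where each variable enters
    through its own measurable function. *)
Lemma measurable_dist : measurable_fun setT (fun z : T * T => dist z.1 z.2).
Proof.
have [q hq] := doubling_separable p.
have mq n : measurable_fun setT (fun x => dist (q n) x).
  apply: measurable_fun_sublevel => r.
  exact: (measurable_dball (q n) r).
apply: measurable_fun_sublevel => r.
rewrite (_ : [set z | _] =
    \bigcup_n [set z : T * T | dist (q n) z.1 + dist (q n) z.2 < r]).
  apply: bigcup_measurable => n _.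
  have mf : measurable_fun setT (fun z : T * T => dist (q n) z.1 + dist (q n) z.2).
    by apply: measurable_funD; apply: (measurableT_comp (mq n)).
  rewrite -[X in measurable X]setTI.
  have := mf measurableT _ (measurable_itv `]-oo, r[).
  by congr (measurable (_ `&` _)); apply/seteqP; split => z /=; rewrite in_itv.
apply/seteqP; split => -[x y] /=.
  move=> xy; have e0 : 0 < (r - dist x y) / 2 by rewrite divr_gt0// subr_gt0.
  have [n hn] := hq x _ e0; exists n => //=.
  have := dist_triangle (q n) x y.
  by rewrite (dist_sym (q n) x); lra.
move=> [n _ /=]; have := dist_triangle x (q n) y.
by rewrite (dist_sym x (q n)); lra.
Qed.

Let measurable_dist_comp d' (S : measurableType d') (f g : S -> T) :
  measurable_fun setT f -> measurable_fun setT g ->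
  measurable_fun setT (fun z => dist (f z) (g z)).
Proof.
by move=> mf mg; exact: measurableT_comp measurable_dist (measurable_fun_pair mf mg).
Qed.

(** The ball is the section at z of a measurable subset of [S * T], and sections have measurable
    mass since [mu] is sigma-finite. *)
Lemma measurable_mu_dball d' (S : measurableType d') (f : S -> T) (g : S -> R) :
  measurable_fun setT f -> measurable_fun setT g ->
  measurable_fun setT (fun z => mu (B (f z) (g z))).
Proof.
move=> mf mg.
have mA : measurable [set z : S * T | dist (f z.1) z.2 < g z.1].
  have /(_ measurableT [set true]) := measurable_fun_ltr
    (measurable_dist_comp _ _ _ _ (measurableT_comp mf (@measurable_fst _ _ S T))
      (@measurable_snd _ _ S T))
    (measurableT_comp mg (@measurable_fst _ _ S T)).
  by rewrite setTI; apply.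
exact: (measurable_fun_section mu mu_sf _ _ _ mA).
Qed.

Lemma measurable_Ks s : measurable_fun setT (fun z : T * T => Ks dist mu s z.1 z.2).
Proof.
(* Balls have finite mass, so the kernel is the inverse of a real function. On the diagonal the
   balls are empty and both forms equal [+oo]. *)
pose g (z : T * T) : \bar R := (2%:E * ((dist z.1 z.2 `^ s *
  (fine (mu (B z.1 (dist z.1 z.2)))
   + fine (mu (B z.2 (dist z.1 z.2)))))%R%:E)^-1)%E.
apply: (eq_measurable_fun g) => [z _|].
  rewrite /g /Ks; congr (_ * inve _)%E; rewrite EFinM EFinD !fineK//;
  exact: mu_dball_fin_num.
apply: measurable_funeM; apply: (measurableT_comp measurable_inve_EFin).
apply: measurable_funM.
  exact: (measurableT_comp (measurable_powR _) measurable_dist).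
apply: measurable_funD; apply: (measurableT_comp (fine_measurable measurableT));
  apply: measurable_mu_dball measurable_dist;
  [exact: measurable_fst|exact: measurable_snd].
Qed.

Lemma Ks_ge0 s x y : (0 <= Ks dist mu s x y)%E.
Proof.
rewrite /Ks mule_ge0// inve_ge0 mule_ge0 ?lee_fin ?powR_ge0//.
by rewrite adde_ge0.
Qed.

Lemma Ks_sym s x y : Ks dist mu s x y = Ks dist mu s y x.
Proof. by rewrite /Ks (dist_sym y x) addeC. Qed.

Local Notation L := (Ls dist mu).
Local Open Scope ereal_scope.

Lemma measurable_Ks_in s x A : measurable_fun A (Ks dist mu s x).
Proof.
apply: (measurable_funS measurableT) => //.
exact: (measurableT_comp (measurable_Ks s) (pair1_measurable x)).
Qed.

Lemma measurable_Ks_integral s A D : measurable A ->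
  measurable_fun D (fun x => \int[mu]_(y in A) Ks dist mu s x y).
Proof.
move=> mA; apply: (measurable_funS measurableT) => //.
exact: (measurable_fun_inner_integral mu mu_sf _ _ _ (measurable_Ks s)
  (fun z => Ks_ge0 s z.1 z.2)).
Qed.

Lemma Ks_integral_ge0 s A x : 0 <= \int[mu]_(y in A) Ks dist mu s x y.
Proof. by apply: integral_ge0 => y _; exact: Ks_ge0. Qed.

Lemma Ls_ge0 s A D : 0 <= L s A D.
Proof. by apply: integral_ge0 => x _; exact: Ks_integral_ge0. Qed.

Lemma Ls_sym s A D : measurable A -> measurable D -> L s A D = L s D A.
Proof.
move=> mA mD; rewrite /Ls.
have := tonelli_sets mu mu (fun z => Ks dist mu s z.1 z.2) A D mu_sf mu_sf
  (measurable_Ks s) (fun z => Ks_ge0 s z.1 z.2) mA mD.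
move=> /= ->.
apply: eq_integral => x _; apply: eq_integral => y _ /=; exact: Ks_sym.
Qed.

Lemma Ls_setUl s A A' D : measurable A -> measurable A' -> measurable D ->
  A `&` A' = set0 -> L s (A `|` A') D = L s A D + L s A' D.
Proof.
move=> mA mA' mD AA'; rewrite /Ls ge0_integral_setU//.
- exact: measurable_Ks_integral.
- by move=> x _; exact: Ks_integral_ge0.
- exact/disj_set2P.
Qed.

Lemma Ls_setUr s A D D' : measurable A -> measurable D -> measurable D' ->
  D `&` D' = set0 -> L s A (D `|` D') = L s A D + L s A D'.
Proof.
move=> mA mD mD' DD'; have mU := measurableU _ _ mD mD'.
rewrite (Ls_sym s A _ mA mU) (Ls_sym s A D mA mD) (Ls_sym s A D' mA mD').
exact: Ls_setUl.
Qed.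

Lemma le_Ls s A A' D D' : measurable A -> measurable A' -> measurable D ->
  measurable D' -> A `<=` A' -> D `<=` D' -> L s A D <= L s A' D'.
Proof.
move=> mA mA' mD mD' AA' DD'.
rewrite -(setDUK AA') Ls_setUl//; [|exact: measurableD|by rewrite setDIK].
rewrite -(setDUK DD') Ls_setUr//; [|exact: measurableD|by rewrite setDIK].
by rewrite -addeA leeDl// adde_ge0 ?Ls_ge0.
Qed.

Lemma Js_split s O E : measurable O -> measurable E ->
  Js dist mu s O E =
  L s (E `&` O) (O `\` E) + L s (E `&` O) (~` (E `|` O)) + L s (E `\` O) (O `\` E).
Proof.
move=> mO mE; rewrite /Js; congr (_ + _).
have -> : ~` E = (O `\` E) `|` ~` (E `|` O).
  apply/seteqP; split => x /=; last by move=> [[]//|/not_orP[]].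
  by move=> nE; have [Ox|Ox] := pselect (O x); [left|right => -[]].
apply: Ls_setUr; first exact: measurableI.
- exact: measurableD.
- by apply: measurableC; exact: measurableU.
- by apply/seteqP; split => x //= -[[Ox nEx]]; apply; right.
Qed.

(** Of the three interactions in [Js_split], complementation swaps the two sets of the first and
    exchanges the other two; symmetry of [L] does the rest. *)
Lemma Js_setC s O E : measurable O -> measurable E ->
  Js dist mu s O (~` E) = Js dist mu s O E.
Proof.
move=> mO mE; rewrite (Js_split s O E mO mE) (Js_split s O _ mO (measurableC mE)).
have -> : ~` E `&` O = O `\` E by rewrite setIC.
have -> : O `\` ~` E = E `&` O by rewrite setDE setCK setIC.
have -> : ~` (~` E `|` O) = E `\` O by rewrite setCU setCK.
have -> : ~` E `\` O = ~` (E `|` O) by rewrite setCU.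
have m1 : measurable (O `\` E) by exact: measurableD.
have m2 : measurable (E `&` O) by exact: measurableI.
have m3 : measurable (E `\` O) by exact: measurableD.
have m4 : measurable (~` (E `|` O)) by apply: measurableC; exact: measurableU.
rewrite (Ls_sym s (O `\` E) _ m1 m2) (Ls_sym s (O `\` E) _ m1 m3).
rewrite (Ls_sym s (~` (E `|` O)) _ m4 m2); exact: addeAC.
Qed.

(** With D = (E ∩ O) \ A, both energies contain L(D, X \ E) and L(E \ O, O \ E). What remains is
    L(A, X \ E) for E and L(D, A) + L(E \ O, A) for the competitor, and D together with E \ O is E \
    A. *)
Lemma Ls_minimal s O E A : measurable O -> measurable E -> measurable A ->
  A `<=` E `&` O -> Js dist mu s O E < +oo ->
  Js dist mu s O E <= Js dist mu s O (E `\` A) ->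
  L s A (~` E) <= L s A (E `\` A).
Proof.
move=> mO mE mA AEO Jfin; rewrite /Js.
set D := (E `&` O) `\` A.
have mEO : measurable (E `&` O) by exact: measurableI.
have mD : measurable D by exact: measurableD.
have mcE : measurable (~` E) by exact: measurableC.
have mEmO : measurable (E `\` O) by exact: measurableD.
have mOmE : measurable (O `\` E) by exact: measurableD.
have e1 : E `&` O = A `|` D by rewrite /D setDUK.
have e2 : (E `\` A) `&` O = D by rewrite /D !setDE setIAC.
have e3 : ~` (E `\` A) = ~` E `|` A by rewrite setCD.
have e4 : (E `\` A) `\` O = E `\` O.
  apply/seteqP; split => x /=; first by case=> -[].
  by move=> [Ex nOx]; split => //; split => // /AEO[].
have e5 : O `\` (E `\` A) = (O `\` E) `|` A.
  apply/seteqP; split => x /=.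
    move=> [Ox h]; have [Ax|Ax] := pselect (A x); [by right|left; split => // Ex].
    by apply: h.
  by move=> [[Ox nE]|/[dup] /AEO[Ex Ox] Ax]; split => // -[].
have e6 : E `\` A = D `|` (E `\` O).
  apply/seteqP; split => x /=.
    by move=> [Ex nA]; have [Ox|Ox] := pselect (O x); [left|right].
  by move=> [[[Ex Ox] nA]//|[Ex nO]]; split => // /AEO[].
rewrite e2 e3 e4 e5 e1 (Ls_setUl s A D _ mA mD mcE (setDIK _ _)).
have d1 : ~` E `&` A = set0.
  by apply/seteqP; split => x //= -[nE /AEO[]].
have d2 : (O `\` E) `&` A = set0.
  by apply/seteqP; split => x //= -[[Ox nE] /AEO[]].
rewrite (Ls_setUr s D _ _ mD mcE mA d1) (Ls_setUr s _ _ _ mEmO mOmE mA d2).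
rewrite e6 (Ls_setUr s A _ _ mA mD mEmO); last first.
  by apply/seteqP; split => x //= -[[[Ex Ox] nA] []].
rewrite (Ls_sym s A D mA mD) (Ls_sym s A (E `\` O) mA mEmO).
set x := L s D (~` E); set y := L s (E `\` O) (O `\` E).
(* The common terms are at most the finite energy of [E], so they may be cancelled. *)
have xyfin : x + y \is a fin_num.
  have xy0 : 0 <= x + y by apply: adde_ge0; exact: Ls_ge0.
  rewrite ge0_fin_numE//; apply: le_lt_trans Jfin.
  rewrite /Js leeD2r// le_Ls//; exact: subIsetl.
exact: lee_cancel.
Qed.

(** * Kernel estimates *)

Local Open Scope ring_scope.
Local Notation V x r := (fine (mu (B x r))).

Let V_E x r : (V x r)%:E = mu (B x r).
Proof. by rewrite fineK// mu_dball_fin_num. Qed.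

Let V_gt0 x r : 0 < r -> 0 < V x r.
Proof. by move=> r0; rewrite -lte_fin V_E mu_dball_gt0. Qed.

Let le_V x y r t : B x r `<=` B y t -> V x r <= V y t.
Proof. by move=> h; rewrite -lee_fin !V_E le_measure ?inE. Qed.

Let V_doubling x r : 0 < r -> V x (2 * r) <= C * V x r.
Proof. by move=> r0; rewrite -lee_fin EFinM !V_E doubling_ball. Qed.

Lemma Ks_EFin s x y : x <> y -> Ks dist mu s x y =
  (2 / (dist x y `^ s * (V x (dist x y) + V y (dist x y))))%:E.
Proof.
move=> /dist_gt0 d0; rewrite /Ks -(V_E x) -(V_E y) -EFinD -EFinM inver gt_eqF//.
by rewrite mulr_gt0 ?powR_gt0// addr_gt0// V_gt0.
Qed.

(** The two balls in the kernel lie in [B x r] and [B x (2 * r)]; doubling turns this into the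
    factor [1 + C]. *)
Lemma Ks_ge s x y r : 0 <= s -> x <> y -> dist x y < r ->
  ((2 / (r `^ s * ((1 + C) * V x r)))%:E <= Ks dist mu s x y)%E.
Proof.
move=> s0 xy dr; have d0 := dist_gt0 _ _ xy; have r0 := lt_trans d0 dr.
rewrite Ks_EFin// lee_fin ler_pM2l// lef_pV2 ?posrE; first last.
- by rewrite mulr_gt0 ?powR_gt0// addr_gt0// V_gt0.
- by rewrite !mulr_gt0 ?powR_gt0// ?V_gt0//; have := doubling_ge1; lra.
apply: ler_pM; rewrite ?powR_ge0//.
  by rewrite ge0_ler_powR// ?nnegrE ltW.
rewrite mulrDl mul1r lerD//.
  by apply: le_V; apply: subset_dball; rewrite dist_refl add0r ltW.
apply: le_trans (V_doubling x r r0); apply: le_V; apply: subset_dball; lra.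
Qed.

Lemma Ks_le s x y t : 0 <= s -> 0 < t -> t <= dist x y ->
  (Ks dist mu s x y <= (2 / (t `^ s * V x t))%:E)%E.
Proof.
move=> s0 t0 td; have d0 := lt_le_trans t0 td.
have xy : x <> y by move=> xy; move: d0; rewrite xy dist_refl ltxx.
rewrite Ks_EFin// lee_fin ler_pM2l// lef_pV2 ?posrE; first last.
- by rewrite mulr_gt0 ?powR_gt0 ?V_gt0.
- by rewrite mulr_gt0 ?powR_gt0// addr_gt0// V_gt0.
apply: ler_pM; rewrite ?powR_ge0 ?fine_ge0//.
  by rewrite ge0_ler_powR// ?nnegrE ltW.
rewrite -[V x t]addr0 lerD ?fine_ge0//.
by apply: le_V; apply: subset_dball; rewrite dist_refl add0r.
Qed.

(** At least half the mass of [B x r] lies outside [A]. Multiplied by the lower bound of [Ks_ge],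
    the mass of the ball cancels and a constant independent of x is left. *)
Lemma Ls_setC_ge s A r : 0 <= s -> 0 < r -> measurable A ->
  (forall x, A x -> (2%:E * mu A <= mu (B x r))%E) ->
  (((r `^ s * (1 + C))^-1)%:E * mu A <= L s A (~` A))%E.
Proof.
move=> s0 r0 mA hA; rewrite /Ls -(integral_cst mu mA).
have C1 := doubling_ge1.
apply: ge0_le_integral => //.
- by move=> x _; rewrite lee_fin invr_ge0 mulr_ge0 ?powR_ge0//; lra.
- by apply: measurable_Ks_integral; exact: measurableC.
move=> x Ax; have hx := hA x Ax.
have Vx := V_gt0 x r r0.
pose c := 2 / (r `^ s * ((1 + C) * V x r)).
have mBA : measurable (B x r `\` A) by exact: measurableD.
have mcA : measurable (~` A) by exact: measurableC.
have KBA : (\int[mu]_(y in B x r `\` A) Ks dist mu s x y <=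
            \int[mu]_(y in ~` A) Ks dist mu s x y)%E.
  apply: (@ge0_subset_integral _ _ _ mu _ _ mBA mcA (Ks dist mu s x)).
  - exact: measurable_Ks_in.
  - by move=> y _; exact: Ks_ge0.
  - by move=> y [].
apply: (le_trans _ KBA).
apply: (@le_trans _ _ (\int[mu]_(y in B x r `\` A) c%:E)%E); last first.
  apply: (@ge0_le_integral _ _ _ mu _ mBA).
  - by move=> y _; rewrite lee_fin divr_ge0// !mulr_ge0 ?powR_ge0//; lra.
  - exact: measurable_cst.
  - exact: measurable_Ks_in.
  - by move=> y [xy nAy]; apply: Ks_ge => // exy; apply: nAy; rewrite -exy.
rewrite (integral_cst mu mBA).
have muA : (mu A \is a fin_num).
  rewrite ge0_fin_numE// ltNge; apply/negP; rewrite leye_eq => /eqP Ay.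
  by move: hx; rewrite Ay -V_E mulry gtr0_sg// mul1e leye_eq.
have : (mu (B x r) - mu A <= mu (B x r `\` A))%E.
  rewrite measureD//; last exact: mu_dball_lty.
  by rewrite leeB// le_measure ?inE//; exact: measurableI.
move: hx; have f1 : mu (B x r `\` A) \is a fin_num.
  rewrite ge0_fin_numE//; apply: le_lt_trans (mu_dball_lty x r).
  by rewrite le_measure ?inE.
rewrite -V_E -(fineK muA) -(fineK f1) -!EFinM -EFinB !lee_fin => h1 h2.
rewrite /c (_ : _ / _ * _ = (r `^ s * (1 + C))^-1 *
  (2 * fine (mu (B x r `\` A)) / V x r)); last first.
  by field; rewrite !gt_eqF ?powR_gt0//; lra.
rewrite ler_peMr//; first by rewrite invr_ge0 mulr_ge0 ?powR_ge0//; lra.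
rewrite ler_pdivlMr//; lra.
Qed.

(** On the annulus between radii [2^k t] and [2^(k+1) t], the mass of [B x (2^k t)] in the kernel
    bound cancels, by doubling, against that of the annulus. A geometric series of ratio [2^-s]
    remains. *)
Lemma Ks_tail_le s x t : 0 < s -> 0 < t ->
  (\int[mu]_(y in ~` B x t) Ks dist mu s x y
    <= (2 * C / (t `^ s) / (1 - (2 `^ s)^-1))%:E)%E.
Proof.
move=> s0 t0; have C1 := doubling_ge1.
have p2 k : 0 < 2 ^+ k * t by rewrite mulr_gt0// exprn_gt0.
have ts := powR_gt0 s t0.
have b1 : 1 < 2 `^ s by rewrite powR_gt1// ltr1n.
apply: (@integral_shells_le _ _ _ _ _ _
  (fun k => B x (2 ^+ k.+1 * t) `\` B x (2 ^+ k * t))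
  (fun k => 2 / ((2 ^+ k * t) `^ s * V x (2 ^+ k * t)))).
- exact: measurableC.
- exact: measurable_Ks_in.
- by move=> y _; exact: Ks_ge0.
- by move=> k; exact: measurableD.
- move=> y /= /negP; rewrite -leNgt => ty.
  have ex : exists n, dist x y < 2 ^+ n.+1 * t.
    exists (Num.truncn (dist x y / t)); rewrite -ltr_pdivrMr//.
    apply: lt_trans (truncnS_gt _) _; rewrite -natrX ltr_nat.
    exact: ltn_expl.
  pose n := ex_minn ex; exists n => //.
  rewrite /n; case: ex_minnP => m hm minm; split => //=; apply/negP; rewrite -leNgt.
  case: m hm minm => [|m] hm minm; first by rewrite expr0 mul1r.
  by rewrite leNgt; apply/negP => /minm; rewrite ltnn.
- by move=> k; rewrite divr_ge0// mulr_ge0 ?powR_ge0 ?fine_ge0.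
- by move=> k y _ [_ /negP]; rewrite -leNgt; apply: Ks_le => //; exact: ltW.
- by rewrite divr_ge0 ?mulr_ge0 ?ltW//; lra.
- by rewrite invr_ge0 powR_ge0/= invf_lt1// (lt_trans _ b1).
move=> k.
apply: (@le_trans _ _ ((2 / ((2 ^+ k * t) `^ s * V x (2 ^+ k * t)))%:E *
  (C * V x (2 ^+ k * t))%:E)%E).
  rewrite lee_wpmul2l//; first by rewrite lee_fin divr_ge0// mulr_ge0 ?powR_ge0 ?fine_ge0.
  apply: (@le_trans _ _ (mu (B x (2 ^+ k.+1 * t)))).
    by apply: le_measure; rewrite ?inE//; exact: measurableD.
  by rewrite -V_E lee_fin exprS -mulrA V_doubling.
rewrite -EFinM lee_fin powRM; [|exact: exprn_ge0|exact: ltW].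
rewrite powR_exprn//.
rewrite exprVn le_eqVlt; apply/orP; left; apply/eqP; field.
by rewrite (gt_eqF (V_gt0 _ _ (p2 k))) (gt_eqF ts) expf_neq0// gt_eqF// (lt_trans _ b1).
Qed.

Lemma Ks_tail_neg_powR s x0 r x : 0 < s -> B x0 r x ->
  (\int[mu]_(y in ~` B x0 r) Ks dist mu s x y
    <= ((2 * C / (1 - (2 `^ s)^-1)) * neg_powR s (r - dist x0 x))%:E)%E.
Proof.
move=> s0 xr; have rx0 : 0 < r - dist x0 x by rewrite subr_gt0.
have mc z t : measurable (~` B z t) by exact: measurableC.
apply: (@le_trans _ _ (\int[mu]_(y in ~` B x (r - dist x0 x)) Ks dist mu s x y)%E).
  apply: (@ge0_subset_integral _ _ _ mu _ _ (mc _ _) (mc _ _) (Ks dist mu s x)).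
  - exact: measurable_Ks_in.
  - by move=> y _; exact: Ks_ge0.
  - by apply: subsetC; apply: subset_dball; rewrite addrC subrK.
apply: (le_trans (Ks_tail_le s x _ s0 rx0)).
by rewrite lee_fin /neg_powR rx0 powRN mulrAC.
Qed.

Lemma measurable_dist_from x0 : measurable_fun setT (dist x0).
Proof. exact: (measurableT_comp measurable_dist (pair1_measurable x0)). Qed.

(* Averaging the hypothesis over the radii r in ]r1, r2] turns the tail
   (r - d(x0, x))^-s, whose L^1 norm over B(x0, r) may be infinite for some r,
   into an integrable singularity. *)
Lemma averaged_tail_le (kappa s r1 r2 : R) E x0 : 0 < s < 1 -> r1 < r2 ->
  0 <= kappa -> measurable E ->
  (forall r, r1 < r <= r2 -> (kappa%:E * mu (E `&` B x0 r) <=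
     L s (E `&` B x0 r) (~` B x0 r))%E) ->
  (kappa%:E * mu (E `&` B x0 r1) <=
   (2 * C / (1 - (2 `^ s)^-1) * ((r2 - r1) `^ (- s) * 2 `^ s / (1 - 2 `^ s / 2)))%:E
   * mu (E `&` B x0 r2))%E.
Proof.
move=> s01 r12 kappa0 mE hk; have /andP[s0 s1] := s01.
set C2 := 2 * C / (1 - (2 `^ s)^-1).
have C20 : 0 <= C2.
  have := doubling_ge1; have := powR_gt1 2 s; rewrite ltr1n => /(_ isT s0) b1 C1.
  apply: divr_ge0; first by rewrite mulr_ge0//; lra.
  by rewrite subr_ge0 invf_le1 ?(lt_trans _ b1)// ltW.
have mEB r : measurable (E `&` B x0 r) by exact: measurableI.
pose h (z : R * T) : \bar R := (C2 * neg_powR s (z.1 - dist x0 z.2))%:E.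
have h0 z : (0 <= h z)%E by rewrite lee_fin mulr_ge0// neg_powR_ge0.
have mh : measurable_fun setT h.
  apply/measurable_EFinP; apply: measurable_funM; first exact: measurable_cst.
  apply: (measurableT_comp (measurable_neg_powR s)).
  apply: measurable_funB; first exact: measurable_fst.
  exact: (measurableT_comp (measurable_dist_from x0) measurable_snd).
have mh1 r : measurable_fun setT (fun x => h (r, x)).
  exact: (measurableT_comp mh (pair1_measurable r)).
have mh2 x : measurable_fun setT (fun r => h (r, x)).
  exact: (measurableT_comp mh (pair2_measurable x)).
(* Shrinking the set to radius [r1] on the left and enlarging it to [r2] on the right makes both
   domains independent of r, so that the integrals can be exchanged. *)
have radius r : r1 < r <= r2 ->
    (kappa%:E * mu (E `&` B x0 r1) <= \int[mu]_(x in E `&` B x0 r2) h (r, x))%E.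
  move=> r12r; have /andP[r1r rr2] := r12r.
  apply: (@le_trans _ _ (kappa%:E * mu (E `&` B x0 r))%E).
    rewrite lee_wpmul2l ?lee_fin// le_measure ?inE//.
    by apply: setIS; apply: subset_dball; rewrite dist_refl add0r ltW.
  apply: (le_trans (hk r r12r)).
  apply: (@le_trans _ _ (\int[mu]_(x in E `&` B x0 r) h (r, x))%E).
    apply: (@ge0_le_integral _ _ _ mu _ (mEB r)).
    - by move=> x _; exact: Ks_integral_ge0.
    - by apply: measurable_Ks_integral; exact: measurableC.
    - exact: (measurable_funS measurableT).
    - by move=> x [_ xr]; exact: Ks_tail_neg_powR.
  apply: (@ge0_subset_integral _ _ _ mu _ _ (mEB r) (mEB r2) (fun x => h (r, x))).
  - exact: (measurable_funS measurableT).
  - by move=> x _; exact: h0.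
  - by apply: setIS; apply: subset_dball; rewrite dist_refl add0r.
have leb_sf : sigma_finite setT (@lebesgue_measure R) by exact: sigma_finiteT.
have mI : measurable `]r1, r2]%classic by exact: measurable_itv.
have := tonelli_sets lebesgue_measure mu h `]r1, r2]%classic (E `&` B x0 r2)
  leb_sf mu_sf mh h0 mI (mEB r2).
set lhs := LHS; set rhs := RHS => lr.
have r210 : 0 < r2 - r1 by rewrite subr_gt0.
(* Integration over r gives the factor [r2 - r1] on the left; on the right it comes from the radial
   integral. *)
have : ((r2 - r1)%:E * (kappa%:E * mu (E `&` B x0 r1)) <=
  (r2 - r1)%:E * ((C2 * ((r2 - r1) `^ (- s) * 2 `^ s / (1 - 2 `^ s / 2)))%:E
   * mu (E `&` B x0 r2)))%E.
  apply: (@le_trans _ _ lhs).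
    rewrite muleC.
    have <- : lebesgue_measure `]r1, r2] = (r2 - r1)%:E.
      by rewrite lebesgue_measure_itv/= lte_fin r12 -EFinD.
    rewrite -(integral_cst lebesgue_measure mI).
    apply: (@ge0_le_integral _ _ _ lebesgue_measure _ mI).
    - by move=> r _; rewrite mule_ge0.
    - exact: measurable_cst.
    - apply: (measurable_funS measurableT) => //.
      exact: (measurable_fun_inner_integral mu mu_sf _ _ h mh h0 _ (mEB r2)).
    - by move=> r; rewrite /= in_itv/=; exact: radius.
  rewrite lr muleA -EFinM -(integral_cst mu (mEB r2)).
  apply: (@ge0_le_integral _ _ _ mu _ (mEB r2)).
  - by move=> x _; apply: integral_ge0.
  - apply: (measurable_funS measurableT) => //.
    have mh' : measurable_fun setT (fun z : T * R => h (z.2, z.1)).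
      apply: (measurableT_comp mh).
      by apply: measurable_fun_pair; [exact: measurable_snd|exact: measurable_fst].
    exact: (measurable_fun_inner_integral lebesgue_measure leb_sf _ _
      (fun z : T * R => h (z.2, z.1)) mh' (fun z => h0 _) _ mI).
  - exact: measurable_cst.
  - move=> x _; rewrite /h/=.
    under eq_integral do rewrite EFinM.
    rewrite ge0_integralZl_EFin//.
    + rewrite [leRHS](_ : _ = C2%:E * ((r2 - r1) * (r2 - r1) `^ (- s) * 2 `^ s
        / (1 - 2 `^ s / 2))%:E)%E; last by rewrite -EFinM mulrCA !mulrA.
      by rewrite lee_wpmul2l ?lee_fin//; exact: integral_neg_powR_le.
    + by move=> r _; rewrite lee_fin neg_powR_ge0.
    + apply/measurable_EFinP; apply: (measurable_funS measurableT) => //.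
      apply: (measurableT_comp (measurable_neg_powR s)).
      by apply: measurable_funB => //; exact: measurable_id.
by rewrite lee_pmul2l.
Qed.

(** * The iteration *)

Let V_doubling_iter x r n : 0 < r -> V x (2 ^+ n * r) <= C ^+ n * V x r.
Proof.
move=> r0; elim: n => [|n IH]; first by rewrite !expr0 !mul1r.
rewrite !exprS -!mulrA; apply: le_trans (V_doubling _ _ _) _.
  by rewrite mulr_gt0// exprn_gt0.
by rewrite ler_pM2l// (lt_le_trans ltr01) ?doubling_ge1.
Qed.

(** For x in E ∩ B(x0, r), the ball [B x0 R0] lies in [B x (2 * R0)], which is k+1 doublings above
    [B x (R0 / 2^k)]. Smallness thus means that E ∩ B(x0, r) has at most half the mass of the
    latter. *)
Lemma Ls_ball_ge s x0 R0 r E k : 0 <= s -> measurable E -> 0 < r <= R0 ->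
  (2%:E * mu (E `&` B x0 r) <= (V x0 R0 / C ^+ k.+1)%:E)%E ->
  (L s (E `&` B x0 r) (~` E) <= L s (E `&` B x0 r) (E `\` B x0 r))%E ->
  ((((R0 / 2 ^+ k) `^ s * (1 + C))^-1 / 2)%:E * mu (E `&` B x0 r) <=
    L s (E `&` B x0 r) (~` B x0 r))%E.
Proof.
move=> s0 mE /andP[r0 rR0] small cmp; set A := E `&` B x0 r in small cmp *.
have R00 : 0 < R0 by exact: lt_le_trans rR0.
have C0 : 0 < C by rewrite (lt_le_trans ltr01) ?doubling_ge1.
have rk0 : 0 < R0 / 2 ^+ k by rewrite divr_gt0// exprn_gt0.
have mA : measurable A by exact: measurableI.
have mEB : measurable (E `\` B x0 r) by exact: measurableD.
have mcE : measurable (~` E) by exact: measurableC.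
have iso : ((((R0 / 2 ^+ k) `^ s * (1 + C))^-1)%:E * mu A <= L s A (~` A))%E.
  apply: Ls_setC_ge => // x [_ xr]; apply: (le_trans small).
  rewrite -(V_E x) lee_fin ler_pdivrMr ?exprn_gt0// mulrC.
  apply: le_trans (V_doubling_iter _ _ _ rk0).
  apply: le_V; apply: subset_dball.
  rewrite exprS -mulrA [2 ^+ k * _]mulrC divfK ?expf_neq0//.
  by rewrite dist_sym; move: xr; rewrite /dball/=; lra.
have AE : ~` A = ~` E `|` (E `\` B x0 r).
  apply/seteqP; split => x /=; last by move=> [nE [Ex _]|[Ex nB] [_ Bx]].
  by move=> nA; have [Ex|Ex] := pselect (E x); [right; split => // xB; apply: nA|left].
have cB : ~` E `&` (E `\` B x0 r) = set0.
  by apply/seteqP; split => x //= [nE [Ex _]].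
move: iso; rewrite AE (Ls_setUr s A _ _ mA mcE mEB cB).
move=> h; apply: (lee_half _ _ _ _ _ h (Ls_ge0 _ _ _) cmp).
have sub : E `\` B x0 r `<=` ~` B x0 r by move=> x [].
exact: (le_Ls s A A _ _ mA mA mEB (measurableC (measurable_dball x0 r))
  (@subset_refl _ A) sub).
Qed.

Lemma small_density_decay s x0 R0 E k0 : 0 < s < 1 -> measurable E -> 0 < R0 ->
  2 <= C -> decay_const s C <= (2 `^ s) ^+ k0 ->
  (forall r, 0 < r <= R0 ->
    (L s (E `&` B x0 r) (~` E) <= L s (E `&` B x0 r) (E `\` B x0 r))%E) ->
  2 * fine (mu (E `&` B x0 R0)) <= V x0 R0 / C ^+ k0.+1 ->
  mu (E `&` B x0 (R0 / 2)) = 0%E.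
Proof.
move=> s01 mE R00 C2 hk0 cmp small; have /andP[s0 s1] := s01.
pose v r := fine (mu (E `&` B x0 r)).
have mEB r : measurable (E `&` B x0 r) by exact: measurableI.
have vE r : (v r)%:E = mu (E `&` B x0 r).
  rewrite fineK// ge0_fin_numE//; apply: le_lt_trans (mu_dball_lty x0 r).
  by rewrite le_measure ?inE.
have v_ge0 r : 0 <= v r by exact: fine_ge0.
have le_v r t : r <= t -> v r <= v t.
  move=> rt; rewrite -lee_fin !vE le_measure ?inE//; apply: setIS.
  by apply: subset_dball; rewrite dist_refl add0r.
pose rad j := R0 / 2 * (1 + (2 ^+ j)^-1).
have p2 j : 0 < (2 ^+ j)^-1 :> R by rewrite invr_gt0 exprn_gt0.
have p21 j : (2 ^+ j)^-1 <= 1 :> R by rewrite invf_le1 ?exprn_gt0// exprn_ege1// ler1n.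
have radB j : rad j - rad j.+1 = R0 / 2 ^+ j.+2.
  by rewrite /rad !exprS; field; rewrite expf_neq0.
have rad_lt j : rad j.+1 < rad j by rewrite -subr_gt0 radB divr_gt0// exprn_gt0.
have rad_half j : R0 / 2 <= rad j by rewrite /rad; have := p2 j; nra.
have rad_le j : rad j <= R0 by rewrite /rad; have := p21 j; nra.
have b1 : 1 < 2 `^ s :> R by rewrite powR_gt1// ltr1n.
have step j : 2 * v (rad j) <= V x0 R0 / C ^+ (j + k0).+1 ->
    C * v (rad j.+1) <= v (rad j).
  move=> hj; set k := (j + k0)%N in hj.
  pose kappa := ((R0 / 2 ^+ k) `^ s * (1 + C))^-1 / 2.
  have kappa0 : 0 <= kappa by rewrite divr_ge0// invr_ge0 mulr_ge0 ?powR_ge0//; lra.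
  have := averaged_tail_le kappa s _ _ E x0 s01 (rad_lt j) kappa0 mE.
  have hr r : rad j.+1 < r <= rad j ->
      (kappa%:E * mu (E `&` B x0 r) <= L s (E `&` B x0 r) (~` B x0 r))%E.
    move=> /andP[jr rj]; have rR0 : 0 < r <= R0.
      rewrite (le_trans rj)// (le_lt_trans _ jr)// (le_trans _ (rad_half _))//.
      by rewrite divr_ge0// ltW.
    apply: Ls_ball_ge => //; [exact: ltW| |exact: cmp].
    rewrite -vE -EFinM lee_fin; apply: le_trans hj; rewrite ler_pM2l//; exact: le_v.
  move=> /(_ hr); rewrite -!vE -!EFinM lee_fin radB.
  have b0 : 0 < 2 `^ s :> R by exact: lt_trans b1.
  have powE n : (R0 / 2 ^+ n) `^ s = R0 `^ s / (2 `^ s) ^+ n.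
    rewrite powRM; [|exact: ltW|by rewrite invr_ge0 exprn_ge0].
    by rewrite powRV ?exprn_ge0// powR_exprn.
  rewrite powRN /kappa !powE; move: hk0; rewrite /decay_const /k exprD !exprS.
  have R0s : 0 < R0 `^ s by rewrite powR_gt0.
  move: R0s b0 => + b0; set P := R0 `^ s => R0s.
  set c0 := 2 * C / _; set c1 := 2 `^ s / _.
  rewrite -[_ * 2 `^ s / (1 - _)]mulrA -/c1.
  move: c0 c1 (2 `^ s) b0 (v (rad j.+1)) (v_ge0 (rad j)) => c0 c1 b b0 v'.
  move: (v (rad j)) => w w0.
  have := exprn_gt0 j b0; have := exprn_gt0 k0 b0.
  move: (b ^+ j) (b ^+ k0) => Bj Q Q0 Bj0; rewrite !expr0 !mulr1 => hQ hD.
  have N0 : 0 < Bj / (2 * (1 + C) * P) by rewrite divr_gt0// !mulr_gt0//; lra.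
  (* The factor [Bj / P] comes from the scale R0/2^k on one side and from the gap R0/2^(j+2) between
     radii on the other. It cancels, so one [k0] serves every j; [decay_const] is the constant on
     the right times [C]. *)
  have key : Q * v' <= 2 * (1 + C) * (c0 * c1) * (b * b) * w.
    rewrite -(ler_pM2l N0); move: hD; congr (_ <= _); field;
      rewrite ?(gt_eqF R0s) ?(gt_eqF Q0) ?(gt_eqF Bj0) ?(gt_eqF b0)/=; lra.
  rewrite -(ler_pM2l Q0); nra.
(* The gain of [C] in [step] is exactly what the threshold loses when the scale is halved. *)
have smallj j : 2 * v (rad j) <= V x0 R0 / C ^+ (j + k0).+1.
  elim: j => [|j IH]; first by rewrite /rad expr0 invr1 (_ : _ * _ = R0)//; field.
  have := step j IH; move: IH; rewrite addSn [C ^+ (j + k0).+2]exprS.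
  have := exprn_gt0 (j + k0).+1 (_ : 0 < C); move=> /(_ ltac:(lra)).
  move: (C ^+ _) => c c0; rewrite !ler_pdivlMr ?mulr_gt0//; last lra.
  nra.
suff : v (R0 / 2) <= 0.
  by move=> v0; apply/eqP; rewrite -vE eqe eq_le v0 fine_ge0.
rewrite leNgt; apply/negP => vgt0.
(* A positive [v (R0 / 2)] is a lower bound for every [v (rad n)] and contradicts [smallj] once
   [C^n] is large. *)
have [n hn] := expr_unbounded C (V x0 R0 / v (R0 / 2)) ltac:(lra).
have := smallj n; rewrite leNgt => /negP; apply.
have Cn m : 0 < C ^+ m by rewrite exprn_gt0//; lra.
rewrite ltr_pdivrMr//; apply: (@lt_le_trans _ _ (v (R0 / 2) * C ^+ n)).
  by rewrite mulrC -ltr_pdivrMr.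
have h1 : C ^+ n <= C ^+ (n + k0).+1.
  by rewrite ler_weXn2l//; [lra|rewrite leqW// leq_addr].
have h2 := le_v _ _ (rad_half n).
by have := Cn n; nra.
Qed.

(** * Regular representatives and density of minimizers *)

(** The complement of the support of [mu] restricted to [E]: the measure-theoretic exterior of [E]
    and, for the complement of [E], its interior. *)
Definition null_points (E : set T) : set T :=
  [set x | exists2 r, 0 < r & mu (E `&` B x r) = 0%E].

Lemma dopen_null_points E : measurable E -> dopen dist (null_points E).
Proof.
move=> mE x [r r0 Er]; exists r => // y xy.
exists (r - dist x y); first by rewrite subr_gt0.
have sub : E `&` B y (r - dist x y) `<=` E `&` B x r.
  by apply: setIS; apply: subset_dball; rewrite addrC subrK.
by apply: (subset_measure0 _ _ sub Er); exact: measurableI.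
Qed.

(** Lindelöf argument: each null point lies in a ball of radius 1/(m+1) about some [q n] that is
    null for [E], and there are countably many such balls. *)
Lemma mu_null_points E : measurable E -> mu (E `&` null_points E) = 0%E.
Proof.
move=> mE; have mN := dopen_measurable _ (dopen_null_points E mE).
have [q hq] := doubling_separable p.
pose F n m := [set x | (E `&` B (q n) m.+1%:R^-1) x /\
  mu (E `&` B (q n) m.+1%:R^-1) = 0%E].
have : mu.-negligible (\bigcup_n \bigcup_m F n m).
  apply: negligible_bigcup => n; apply: negligible_bigcup => m.
  have [E0|E0] := pselect (mu (E `&` B (q n) m.+1%:R^-1) = 0%E).
    exists (E `&` B (q n) m.+1%:R^-1); split => //; first exact: measurableI.
    by move=> x [].
  by exists set0; split => // x [].
move=> nF; apply: measure_negligible; first exact: measurableI.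
apply: negligibleS nF.
move=> x [Ex [r r0 Er]]; have r20 : 0 < r / 2 by rewrite divr_gt0.
have [m] := ltr_add_invr r20; rewrite add0r => hm.
have m0 : 0 < m.+1%:R^-1 :> R by rewrite invr_gt0.
have [n hn] := hq x _ m0; exists n => //; exists m => //; split.
  by split => //; rewrite /dball/= dist_sym.
have sub : E `&` B (q n) m.+1%:R^-1 `<=` E `&` B x r.
  by apply: setIS; apply: subset_dball; move: hn hm; set e := _^-1; lra.
by apply: (subset_measure0 _ _ sub Er); exact: measurableI.
Qed.

Lemma null_points_disjoint E x : measurable E ->
  null_points E x -> null_points (~` E) x -> False.
Proof.
move=> mE [r r0 Er] [t t0 Et].
have m0 : 0 < Num.min r t by rewrite lt_min r0.
have := mu_dball_gt0 x _ m0; rewrite ltNge => /negP; apply.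
have mE1 : measurable (E `&` B x r) by exact: measurableI.
have mE2 : measurable (~` E `&` B x t).
  by apply: measurableI => //; exact: measurableC.
apply: (@le_trans _ _ (mu ((E `&` B x r) `|` (~` E `&` B x t)))).
  apply: le_measure; rewrite ?inE//; first exact: measurableU.
  move=> y; rewrite /dball/= lt_min => /andP[yr yt].
  by have [Ey|Ey] := pselect (E y); [left|right].
by rewrite measureU0// Er.
Qed.

Lemma ex_regular_representative E : measurable E -> exists E',
  [/\ measurable E', mu (E `\` E') = 0%E, mu (E' `\` E) = 0%E &
    forall x r, dboundary dist E' x -> 0 < r ->
      (0 < mu (E `&` B x r))%E /\ (0 < mu (~` E `&` B x r))%E].
Proof.
move=> mE; have mcE := measurableC mE.
have oN := dopen_null_points E mE; have oNc := dopen_null_points _ mcE.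
have mN := dopen_measurable _ oN; have mNc := dopen_measurable _ oNc.
exists ((E `|` null_points (~` E)) `\` null_points E).
have mE' : measurable ((E `|` null_points (~` E)) `\` null_points E).
  by apply: measurableD => //; exact: measurableU.
split => //.
- apply: (subset_measure0 _ _ _ (mu_null_points E mE)).
  + exact: measurableD.
  + exact: measurableI.
  + move=> x [Ex nE']; split => //; apply: contrapT => nx; apply: nE'.
    by split => //; left.
- apply: (subset_measure0 _ _ _ (mu_null_points _ mcE)).
  + exact: measurableD.
  + exact: measurableI.
  + by move=> x [[[Ex|Nx] _] nE].
move=> x r bx r0; rewrite !lt_neqAle !measure_ge0 !andbT.
split; rewrite eq_sym; apply/eqP => null.
  have [t t0 sub] := oN x (ex_intro2 _ _ r r0 null).
  by have [[y [/sub Ny [_ nNy]]] _] := bx t t0.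
have [t t0 sub] := oNc x (ex_intro2 _ _ r r0 null).
have [_ [y [/sub Ny nE'y]]] := bx t t0; apply: nE'y; split; first by right.
by move=> Ny'; exact: (null_points_disjoint E y).
Qed.

Lemma minimizer_setC s O F E : measurable O ->
  is_minimizer dist mu s O F E -> is_minimizer dist mu s O (~` F) (~` E).
Proof.
move=> mO [mE Jfin EF minE].
have e A : ~` A `\` O = ~` O `\` (A `\` O).
  apply/seteqP; split => x /=; first by move=> [nA nO]; split => // -[].
  by move=> [nO h]; split => // Ax; apply: h.
have outer A A' : A `\` O = A' `\` O -> ~` A `\` O = ~` A' `\` O.
  by move=> AA'; rewrite !e AA'.
split; [exact: measurableC|by rewrite (Js_setC s O E mO mE)|exact: outer|].
move=> A mA AF; rewrite (Js_setC s O E mO mE) -(Js_setC s O A mO mA).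
apply: minE; first exact: measurableC.
by rewrite (outer _ _ AF) setCK.
Qed.

(** The constant is the threshold of the iteration at j = 0; below it the half ball would carry no
    mass of [E]. Competitors E \ B(x0, r) are admissible because the balls stay in [O]. *)
Lemma minimizer_density s O F E x0 R0 k0 : 0 < s < 1 -> 2 <= C ->
  decay_const s C <= (2 `^ s) ^+ k0 -> measurable O ->
  is_minimizer dist mu s O F E -> 0 < R0 -> B x0 (2 * R0) `<=` O ->
  (0 < mu (E `&` B x0 (R0 / 2)))%E ->
  (2 * C ^+ k0.+1)^-1 * V x0 R0 <= fine (mu (E `&` B x0 R0)).
Proof.
move=> s01 C2 hk0 mO [mE Jfin EF minE] R00 BO Epos.
rewrite leNgt; apply/negP => small.
have sm : 2 * fine (mu (E `&` B x0 R0)) <= V x0 R0 / C ^+ k0.+1.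
  move: small; rewrite invfM -mulrA [C ^- _ * _]mulrC.
  by set u := V x0 R0 / _; set w := fine _; lra.
suff cmp r : 0 < r <= R0 ->
    (L s (E `&` B x0 r) (~` E) <= L s (E `&` B x0 r) (E `\` B x0 r))%E.
  by move: Epos; rewrite (small_density_decay s x0 R0 E k0 s01 mE R00 C2 hk0 cmp sm) ltxx.
move=> /andP[r0 rR0].
have mEB : measurable (E `&` B x0 r) by exact: measurableI.
have sub : E `&` B x0 r `<=` E `&` O.
  apply: setIS; apply: subset_trans BO; apply: subset_dball.
  by rewrite dist_refl; lra.
have ED : E `\` (E `&` B x0 r) = E `\` B x0 r by rewrite setDIr setDv set0U.
rewrite -ED; apply: (Ls_minimal s O E _ mO mE mEB sub Jfin).
apply: minE; first exact: measurableD.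
rewrite -EF; apply/seteqP; split => x /=; first by move=> [[Ex _] nO].
by move=> [Ex nO]; split => //; split => // /sub[].
Qed.

End MetricMeasure.

(** * Both density bounds with a uniform constant *)

Theorem theorem1p4 (R : realType) (s : R) (hs0 : 0 < s) (hs1 : s < 1)
    (C : R) :
  exists2 gamma0 : R, 0 < gamma0 &
  forall (disp : measure_display) (T : measurableType disp)
         (dist : T -> T -> R) (mu : {measure set T -> \bar R}),
    is_metric dist -> dcomplete dist -> dconnected dist setT ->
    doubling_with dist mu C -> borel_regular dist mu ->
    forall Omega : set T, ddomain dist Omega -> dbounded dist Omega ->
    forall F E : set T, measurable F -> F `\` Omega !=set0 ->
    is_minimizer dist mu s Omega F E ->
    exists E' : set T,
      [/\ measurable E',
          mu ((E `\` E') `|` (E' `\` E)) = 0%E &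
          forall (x0 : T) (R0 : R),
            x0 \in dboundary dist E' `&` Omega -> 0 < R0 ->
            dball dist x0 (2 * R0) `<=` Omega ->
            gamma0 <= fine (mu (dball dist x0 R0 `&` E')) /
                      fine (mu (dball dist x0 R0)) /\
            gamma0 <= fine (mu (dball dist x0 R0 `\` E')) /
                      fine (mu (dball dist x0 R0))].
Proof.
(* Doubling persists with a larger constant, and the iteration needs a decay factor of at least 2.
   Both [C'] and [k0] are fixed by [s] and [C] before the space is given. *)
pose C' := Num.max C 2.
have s01 : 0 < s < 1 by rewrite hs0.
have [k0 hk0] : exists k, decay_const s C' < (2 `^ s) ^+ k.
  by apply: expr_unbounded; rewrite powR_gt1// ltr1n.
have C'2 : 2 <= C' by rewrite /C' le_max lexx orbT.
exists (2 * C' ^+ k0.+1)^-1.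
  by rewrite invr_gt0 mulr_gt0// exprn_gt0// (lt_le_trans _ C'2).
move=> disp T dist mu hm _ _ hd [hb _] Omega [oO _] _ F E mF [p _] hmin.
have dom A : dopen dist A -> measurable A.
  by move=> oA; apply: hb; exact: sub_sigma_algebra.
have hd' : doubling_with dist mu C'.
  have fin := mu_dball_lty dist mu C hm hd.
  case: hd => C1 hd; split; first by rewrite le_max C1.
  move=> x r r0; have [h1 [h2 _]] := hd x r r0; split => //; split.
    by apply: (le_trans h2); rewrite lee_wpmul2r// lee_fin le_max lexx.
  by rewrite lte_mul_pinfty// lee_fin (le_trans _ C'2).
have mO := dom _ oO.
have [mE _ _ _] := hmin.
have [E' [mE' EE' E'E bE']] := ex_regular_representative dist mu C' hm hd' dom p E mE.
exists E'; split => //.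
  rewrite measureU0 => //; exact: measurableD.
move=> x0 R0; rewrite inE => -[bx0 _] R00 BO.
have R20 : 0 < R0 / 2 by rewrite divr_gt0.
have [pos posc] := bE' x0 _ bx0 R20.
have mB r : measurable (dball dist x0 r) by exact: measurable_dball.
have fin A : measurable A -> mu (A `&` dball dist x0 R0) \is a fin_num.
  move=> mA; rewrite ge0_fin_numE//.
  apply: le_lt_trans (mu_dball_lty dist mu C' hm hd' x0 R0).
  by rewrite le_measure ?inE//; exact: measurableI.
have V0 : 0 < fine (mu (dball dist x0 R0)).
  rewrite fine_gt0// (mu_dball_gt0 dist mu C' hd')//=.
  exact: (mu_dball_lty dist mu C' hm hd').
(* Inclusion up to a null set suffices to pass lower bounds from [E] to [E'], and from complement to
   complement. *)
have transfer A A' : measurable A -> measurable A' -> mu (A `\` A') = 0%E ->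
    (fine (mu (A `&` dball dist x0 R0)) <= fine (mu (dball dist x0 R0 `&` A')))%R.
  move=> mA mA' AA'; rewrite [dball _ _ _ `&` A']setIC fine_le ?fin//.
  have mAA' : measurable (A `\` A') by exact: measurableD.
  rewrite -(measureU0 (measurableI _ _ mA' (mB R0)) mAA' AA').
  rewrite le_measure ?inE//; first exact: measurableI.
    by apply: measurableU => //; exact: measurableI.
  by move=> x [Ax Bx]; have [A'x|A'x] := pselect (A' x); [left|right].
have mcE := measurableC mE; have mcE' := measurableC mE'.
split; rewrite ler_pdivlMr//.
  apply: le_trans (transfer E E' mE mE' EE').
  exact: (minimizer_density dist mu C' hm hd' dom p s Omega F E x0 R0 k0
    s01 C'2 (ltW hk0) mO hmin R00 BO pos).
have EcE'c : mu (~` E `\` ~` E') = 0%E by rewrite setDE setCK setIC -setDE.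
rewrite setDE; apply: le_trans (transfer _ _ mcE mcE' EcE'c).
exact: (minimizer_density dist mu C' hm hd' dom p s Omega (~` F) (~` E) x0 R0 k0
  s01 C'2 (ltW hk0) mO
  (minimizer_setC dist mu C' hm hd' dom p s Omega F E mO hmin) R00 BO posc).
Qed.
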